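(* For integers $1\le r\le k$, the following identities hold in $\mathcal{A}$: i) $$S(k,r)=(-1)^{k+r}\sum_{\substack{1\leq i\leq r\\ i\equiv k \bmod 2}}\binom{\frac{k-i}{2}}{r-i}B(k,i);$$ ii) $$S_{1}(k,r)=(-1)^{k+r}\sum_{\substack{1\leq i\leq r\\ i\equiv k\bmod 2}}\binom{\frac{k-3i}{2}}{r-i}B_{1}(k,i).$$
   Context: Let $\mathcal{A}=\left(\prod_{p}\mathbb{Z}/p\mathbb{Z}\right)/\left(\bigoplus_{p}\mathbb{Z}/p\mathbb{Z}\right)$, where $p$ runs over all prime numbers; it is a $\mathbb{Q}$-algebra. An element of $\mathcal{A}$ is represented by a family $(a_{(p)})_p$ with $a_{(p)}\in\mathbb{Z}/p\mathbb{Z}$, and two families represent the same element iff they agree for all but finitely many $p$. For positive integers $k_1,\ldots,k_r$, define $\zeta_{\mathcal{A}}^{(2)}(k_1,\ldots,k_r)\in\mathcal{A}$ by $$\zeta_{\mathcal{A}}^{(2)}(k_1,\ldots,k_r)_{(p)}=\sum_{0<m_1<\cdots<m_r<p/2}\frac{1}{m_1^{k_1}\cdots m_r^{k_r}}\bmod p.$$ Define the following sums, each over all tuples of $r$ positive integers $(k_1,\ldots,k_r)$ with the indicated conditions (empty sums are $0$): $$S(k,r)=\sum_{k_1+\cdots+k_r=k}\zeta_{\mathcal{A}}^{(2)}(k_1,\ldots,k_r),\qquad S_1(k,r)=\sum_{\substack{k_1+\cdots+k_r=k\\ \text{all } k_i\ge 2}}\zeta_{\mathcal{A}}^{(2)}(k_1,\ldots,k_r),$$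 $$B(k,r)=\sum_{\substack{k_1+\cdots+k_r=k\\ \text{all } k_i \text{ odd},\ k_i\ge1}}\zeta_{\mathcal{A}}^{(2)}(k_1,\ldots,k_r),\qquad B_1(k,r)=\sum_{\substack{k_1+\cdots+k_r=k\\ \text{all } k_i \text{ odd},\ k_i\ge3}}\zeta_{\mathcal{A}}^{(2)}(k_1,\ldots,k_r).$$ (Note $B_1(k,i)=0$ whenever $k<3i$.) *)

(* Defs.v *)
From HB Require Import structures.
From mathcomp Require Import all_boot all_order all_algebra.
From mathcomp Require Import generic_quotient ring_quotient boolp.

Set Implicit Arguments.
Unset Strict Implicit.
Unset Printing Implicit Defensive.

Import Order.TTheory GRing.Theory Num.Theory.

Local Open Scope ring_scope.
Local Open Scope quotient_scope.

Definition primeT := {p : nat | prime p}.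

Definition prodF := forall p : primeT, 'F_(sval p).

HB.instance Definition _ := Choice.copy prodF (forall p : primeT, 'F_(sval p)).

Definition prodF0 : prodF := fun=> 0.
Definition prodF1 : prodF := fun=> 1.
Definition prodF_opp (a : prodF) : prodF := fun p => - a p.
Definition prodF_add (a b : prodF) : prodF := fun p => a p + b p.
Definition prodF_mul (a b : prodF) : prodF := fun p => a p * b p.

Fact prodF_addA : associative prodF_add.
Proof. by move=> a b c; apply: functional_extensionality_dep => p; apply: addrA. Qed.
Fact prodF_addC : commutative prodF_add.
Proof. by move=> a b; apply: functional_extensionality_dep => p; apply: addrC. Qed.
Fact prodF_add0 : left_id prodF0 prodF_add.
Proof. by move=> a; apply: functional_extensionality_dep => p; apply: add0r. Qed.
Fact prodF_addN : left_inverse prodF0 prodF_opp prodF_add.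
Proof. by move=> a; apply: functional_extensionality_dep => p; apply: addNr. Qed.
HB.instance Definition _ :=
  GRing.isZmodule.Build prodF prodF_addA prodF_addC prodF_add0 prodF_addN.

Fact prodF_mulA : associative prodF_mul.
Proof. by move=> a b c; apply: functional_extensionality_dep => p; apply: mulrA. Qed.
Fact prodF_mulC : commutative prodF_mul.
Proof. by move=> a b; apply: functional_extensionality_dep => p; apply: mulrC. Qed.
Fact prodF_mul1 : left_id prodF1 prodF_mul.
Proof. by move=> a; apply: functional_extensionality_dep => p; apply: mul1r. Qed.
Fact prodF_mulD : left_distributive prodF_mul prodF_add.
Proof. by move=> a b c; apply: functional_extensionality_dep => p; apply: mulrDl. Qed.
Fact prodF_1neq0 : prodF1 != prodF0.
Proof.
apply/eqP => /(congr1 (fun a : prodF => a (exist _ 2 isT))) /eqP.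
by rewrite oner_eq0.
Qed.
HB.instance Definition _ := GRing.Zmodule_isComNzRing.Build prodF
  prodF_mulA prodF_mulC prodF_mul1 prodF_mulD prodF_1neq0.

Definition sumF : {pred prodF} := fun a =>
  `[< exists s : seq nat, forall p : primeT, sval p \notin s -> a p = 0 >].

Fact sumF_idealr_closed : idealr_closed sumF.
Proof.
split; first by apply/asboolP; exists [::].
  apply/negP => /asboolP[s sP].
  have [p lt_p p_pr] := prime_above (\max_(q <- s) q).
  suff /(sP (exist _ p p_pr))/eqP : p \notin s by rewrite oner_eq0.
  by apply: contraL lt_p => ps; rewrite -leqNgt leq_bigmax_seq.
move=> c a b /asboolP[s sP] /asboolP[t tP]; apply/asboolP.
exists (s ++ t) => p; rewrite mem_cat negb_or => /andP[ps pt].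
by rewrite -[LHS]/(c p * a p + b p) sP // tP // mulr0 addr0.
Qed.
HB.instance Definition _ :=
  GRing.isZmodClosed.Build prodF sumF (idealr_closedB sumF_idealr_closed).
HB.instance Definition _ :=
  isProperIdeal.Build prodF sumF (idealr_closed_nontrivial sumF_idealr_closed).

(* A notation, so that the ring structure and the projection of the ideal      *)
(* quotient are available as they are.                                         *)
Notation calA := {ideal_quot sumF}.

(* The bound m_i < p / 2 is in the rationals, hence 2 * m_i < p and not        *)
(* m_i < p %/ 2; every such m_i is invertible in 'F_p.                         *)
Definition zetaA2 (r : nat) (k : r.-tuple nat) : calA :=
  \pi_calA ((fun p =>
    \sum_(m : r.-tuple 'I_(sval p)
          | [forall i, (0 < tnth m i)%N && (2 * tnth m i < sval p)%N]
            && [forall i : 'I_r, forall j : 'I_r,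
                  (i < j)%N ==> (tnth m i < tnth m j)%N])
      (\prod_(i < r) (tnth m i)%:R ^+ tnth k i)^-1) : prodF).

(* Sum over the r-tuples of positive integers of sum k whose entries satisfy   *)
(* P; the entries of such a tuple are at most k, so they range over 'I_k.+1.   *)
Definition sumzeta (P : pred nat) (k r : nat) : calA :=
  \sum_(t : r.-tuple 'I_k.+1
        | (\sum_(i < r) tnth t i == k)%N
          && [forall i, (0 < tnth t i)%N && P (tnth t i)])
    zetaA2 [tuple of map val t].

Definition Ssum (k r : nat) : calA := sumzeta predT k r.
Definition S1sum (k r : nat) : calA := sumzeta (fun n => 2 <= n)%N k r.
Definition Bsum (k r : nat) : calA := sumzeta (fun n => odd n && (1 <= n)%N) k r.
Definition B1sum (k r : nat) : calA := sumzeta (fun n => odd n && (3 <= n)%N) k r.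

(* Main.v *)
From HB Require Import structures.
Require Import Defs.
From mathcomp Require Import all_boot all_order all_algebra.
From mathcomp Require Import generic_quotient ring_quotient ring zify boolp.

(** Both identities hold in 'F_p itself for every odd prime p > k + 1; they are
    equalities of coefficients of X^k Y^r in two products over the m < p / 2.
    Put u = X / m and D = 1 + Y.

    Summing the truncated multiple zeta values over compositions with parts at
    least d, with weight -Y for each part, amounts to expanding the product of
    the factors 1 - Y (u^d + u^(d+1) + ...).  Summing over compositions with
    odd parts at least e, with weight Y (-1)^j D^((j-e)/2) for a part j, amounts
    to expanding the product of the factors
    1 - Y (u^e + D u^(e+2) + D^2 u^(e+4) + ...).  In the second case a composition
    of k into i parts has total weight Y^i (-1)^k D^((k-ei)/2), whose coefficients
    are, up to sign, the binomial coefficients of the theorem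
    ([coef_geo_prod], [coef_oddgeo_prod]).

    Summing the geometric series, the factors are
      (1 - u - Y u^d) / (1 - u)   and   (1 - D u^2 - Y u^e) / (1 - D u^2),
    and for (d, e) = (1, 1) and (2, 3) one has
      (1 - u - Y u^d) (1 + u) = 1 - D u^2 - Y u^e.
    So the two products differ only by the ratio of the product of the 1 - u^2
    to the product of the 1 - D u^2.  Since the squares m^2, m < p / 2, are the
    roots of T^((p-1)/2) - 1 in 'F_p, the product of the 1 - T / m^2 is
    1 - T^((p-1)/2) ([half_range_product]); with T = u^2 m^2 = X^2 or T = D X^2
    this is 1 modulo X^(p-1), and both products agree in degree k
    ([prod_geo_eq_oddgeo], [compsum_identity]).  Discarding finitely many
    primes, the identities pass to the quotient ring. *)

Set Implicit Arguments.
Unset Strict Implicit.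
Unset Printing Implicit Defensive.
Import GRing.Theory.
Local Open Scope ring_scope.

(** * Products over a finite range and sums over compositions *)

Definition increasing n r (m : r.-tuple 'I_n) :=
  [forall i : 'I_r, forall j : 'I_r, (i < j)%N ==> (tnth m i < tnth m j)%N].

Lemma increasingE n r (m : r.-tuple 'I_n) :
  increasing m = sorted ltn (map val m).
Proof.
case: n m => [|n] m.
  case: r m => [m|r m]; last by case: (tnth m ord0).
  by rewrite tuple0; apply/forallP => -[].
have sz : size (map val m) = r by rewrite size_map size_tuple.
apply/idP/idP => [/forallP m_inc | m_sorted].
  apply/(sortedP 0%N) => i; rewrite sz => i_lt.
  have [lt0 lt1] : (i < r)%N /\ (i.+1 < r)%N by split=> //; apply: ltnW.
  have /implyP/(_ (leqnn _)) := forallP (m_inc (Ordinal lt0)) (Ordinal lt1).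
  by rewrite !(tnth_nth ord0) /= !(nth_map ord0) ?size_tuple.
apply/forallP => i; apply/forallP => j; apply/implyP => lt_ij.
have := sorted_ltn_nth ltn_trans 0%N m_sorted.
move=> /(_ i j); rewrite !inE !sz !ltn_ord => /(_ isT isT lt_ij).
by rewrite !(tnth_nth ord0) !(nth_map ord0) ?size_tuple.
Qed.

(** A set of r indices is listed by exactly one increasing r-tuple.  Two increasing
    tuples with the same entries are equal, and there are as many of them as there
    are sets of r indices. *)
Lemma sum_sets_of_card (R : nmodType) n r (F : {set 'I_n} -> R) :
  \sum_(A : {set 'I_n} | #|A| == r) F A =
  \sum_(m : r.-tuple 'I_n | increasing m) F [set i in m].
Proof.
pose D := [set m : r.-tuple 'I_n | sorted ltn (map val m)].
pose entries (m : r.-tuple 'I_n) := [set i in m].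
have entries_inj : {in D &, injective entries}.
  move=> m m'; rewrite !inE => m_inc m'_inc /setP eq_mm'; apply: val_inj.
  apply: (inj_map val_inj); apply: (irr_sorted_eq ltn_trans ltnn) => // v.
  by apply/mapP/mapP => -[i i_in ->]; exists i => //; have := eq_mm' i; rewrite !inE i_in.
have imD : entries @: D = [set A : {set 'I_n} | #|A| == r].
  apply/eqP; rewrite eqEcard card_in_imset // card_ltn_sorted_tuples card_draws card_ord.
  rewrite leqnn andbT; apply/subsetP => _ /imsetP[m m_inc ->]; rewrite !inE in m_inc *.
  rewrite cardsE (card_uniqP _) ?size_tuple // -(map_inj_uniq val_inj).
  exact: sorted_uniq ltn_trans ltnn _ m_inc.
transitivity (\sum_(A in entries @: D) F A).
  by apply: eq_bigl => A; rewrite imD inE.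
by rewrite big_imset //; apply: eq_bigl => m; rewrite inE increasingE.
Qed.

Lemma prod_set_tuple (R : comPzRingType) n r (m : r.-tuple 'I_n) (G : 'I_n -> R) :
  increasing m -> \prod_(i in [set i in m]) G i = \prod_(l < r) G (tnth m l).
Proof.
rewrite increasingE => /(sorted_uniq ltn_trans ltnn).
rewrite (map_inj_uniq val_inj) => m_uniq.
under eq_bigl do rewrite inE.
by rewrite -(big_uniq _ m_uniq) big_tuple.
Qed.

(** The terms of the expanded product are indexed by sets, which are grouped here
    by size.  Leaving the bound N on the size free lets two expansions be
    compared term by term, and puts any prescribed r in range. *)
Lemma prod_1D_increasing (R : comPzRingType) n N (Q : pred 'I_n) (G : 'I_n -> R) :
    (n < N)%N ->
  \prod_(i < n | Q i) (1 + G i) =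
  \sum_(r < N)
    \sum_(m : r.-tuple 'I_n | [forall l, Q (tnth m l)] && increasing m)
       \prod_(l < r) G (tnth m l).
Proof.
move=> ltnN; pose H i := if Q i then G i else 0.
transitivity (\prod_(i < n) (H i + 1)).
  rewrite big_mkcond; apply: eq_bigr => i _.
  by rewrite /H addrC; case: (Q i); rewrite ?add0r.
rewrite bigA_distr /=.
have cardA (A : {set 'I_n}) : (#|A| < N)%N.
  by apply: leq_ltn_trans ltnN; rewrite -[X in (_ <= X)%N]card_ord max_card.
rewrite (partition_big (fun A => Ordinal (cardA A)) predT) //=.
apply: eq_bigr => r _.
transitivity (\sum_(A : {set 'I_n} | #|A| == r) \prod_(i in A) H i).
  by apply: eq_bigr => A _; rewrite -big_mkcond.
rewrite sum_sets_of_card [RHS]big_mkcondl /=.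
apply: eq_bigr => m m_inc; rewrite prod_set_tuple // /H.
case: forallP => [allQ | /forallP].
  by apply: eq_bigr => l _; rewrite allQ.
rewrite negb_forall => /existsP[l /negbTE nQ].
by rewrite (bigD1 l) //= nQ mul0r.
Qed.

(** A monomial quasisymmetric function.  For a i = 1 / i and Q selecting the indices
    below p / 2 it is the p-component of the truncated multiple zeta value. *)
Definition monomial_qsym (R : comPzRingType) n (Q : pred 'I_n) (a : 'I_n -> R) r
    (t : 'I_r -> nat) : R :=
  \sum_(m : r.-tuple 'I_n | [forall l, Q (tnth m l)] && increasing m)
     \prod_(l < r) a (tnth m l) ^+ t l.

Definition composition (P : pred nat) k r (t : r.-tuple 'I_k.+1) :=
  (\sum_(i < r) tnth t i == k)%N && [forall i, (0 < tnth t i)%N && P (tnth t i)].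

(** Each factor is 1 plus the contribution of an index used with multiplicity j,
    so a term of degree k in the expansion picks an increasing tuple of indices
    and a composition of k recording their multiplicities.  Any weight that is
    multiplicative over the parts can be carried along. *)
Lemma coef_prod_parts (R : comNzRingType) n N k (Q : pred 'I_n) (P : pred nat)
    (a : 'I_n -> R) (w : nat -> R) : (n < N)%N ->
  (\prod_(i < n | Q i)
     (1 + \poly_(j < k.+1) (if (0 < j)%N && P j then w j * a i ^+ j else 0)))`_k =
  \sum_(r < N) \sum_(t : r.-tuple 'I_k.+1 | composition P t)
     (\prod_(l < r) w (tnth t l)) * monomial_qsym Q a (fun l => tnth t l).
Proof.
move=> ltnN; rewrite (prod_1D_increasing _ _ ltnN) coef_sum.
apply: eq_bigr => r _; rewrite coef_sum.
(* Parts that are not allowed get weight 0, so that all functions from the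
   positions to the parts can be summed over. *)
pose c j := if (0 < j)%N && P j then w j else 0.
under eq_bigr => m _.
  under eq_bigr => l _ do rewrite poly_def.
  rewrite bigA_distr_bigA coef_sum /=.
  rewrite (reindex (fun t : r.-tuple 'I_k.+1 => [ffun l => tnth t l])) /=; last first.
    exists (fun f : {ffun 'I_r -> 'I_k.+1} => [tuple f l | l < r]) => [t|f] _.
      by apply: eq_from_tnth => l; rewrite tnth_mktuple ffunE.
    by apply/ffunP => l; rewrite ffunE tnth_mktuple.
  under eq_bigr => t _.
    under eq_bigr => l _.
      rewrite ffunE (_ : (if _ then _ else _) =
        c (tnth t l) * a (tnth m l) ^+ tnth t l); last first.
        by rewrite /c; case: ifP => // _; rewrite mul0r.
      over.
    rewrite scaler_prod -expr_sum coefZ coefXn big_split /=.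
    over.
  over.
rewrite exchange_big [RHS]big_mkcond /=; apply: eq_bigr => t _.
rewrite /composition eq_sym; case: eqP => /= _; last first.
  by rewrite big1 // => m _; rewrite mulr0.
case: forallP => [allP | /forallP].
  rewrite /monomial_qsym mulr_sumr; apply: eq_bigr => m _; rewrite mulr1; congr (_ * _).
  by apply: eq_bigr => l _; rewrite /c allP.
rewrite negb_forall => /existsP[l /negbTE nP].
by rewrite big1 // => m _; rewrite (bigD1 l) //= /c nP !mul0r.
Qed.

(** * Geometric factors modulo a power of X *)

Definition eq_modXn (R : nzRingType) n (p q : {poly R}) :=
  forall i, (i < n)%N -> p`_i = q`_i.

Lemma eq_modXn_sym (R : nzRingType) n (p q : {poly R}) :
  eq_modXn n p q -> eq_modXn n q p.
Proof. by move=> eqpq i lt_in; rewrite eqpq. Qed.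

Lemma eq_modXn_trans (R : nzRingType) n (q p r : {poly R}) :
  eq_modXn n p q -> eq_modXn n q r -> eq_modXn n p r.
Proof. by move=> eqpq eqqr i lt_in; rewrite eqpq ?eqqr. Qed.

Lemma eq_modXn_mul (R : nzRingType) n (p p' q q' : {poly R}) :
  eq_modXn n p p' -> eq_modXn n q q' -> eq_modXn n (p * q) (p' * q').
Proof.
move=> eqp eqq i lt_in; rewrite !coefM; apply: eq_bigr => j _.
rewrite eqp ?eqq //; first exact: leq_ltn_trans (leq_subr _ _) lt_in.
by apply: leq_trans lt_in; rewrite ltnS -ltnS.
Qed.

Lemma eq_modXn_prod (R : nzRingType) n (I : finType) (Q : pred I) (f g : I -> {poly R}) :
  (forall i, Q i -> eq_modXn n (f i) (g i)) ->
  eq_modXn n (\prod_(i | Q i) f i) (\prod_(i | Q i) g i).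
Proof. by move=> eqfg; elim/big_ind2: _ => // *; apply: eq_modXn_mul. Qed.

Section Factors.
Variables (R : comNzRingType) (y : R).

Definition geo d n (a : R) : {poly R} :=
  1 + \poly_(j < n) (if (0 < j)%N && (d <= j)%N then - y * a ^+ j else 0).

Definition odd_weight e j : R := y * (-1) ^+ j * (1 + y) ^+ ((j - e) %/ 2).

Definition oddgeo e n (a : R) : {poly R} :=
  1 + \poly_(j < n)
    (if (0 < j)%N && (odd j && (e <= j)%N) then odd_weight e j * a ^+ j else 0).

(** Multiplying the truncated series by 1 - u telescopes it; the error is in
    degree n and above. *)
Lemma geo_factor d n a : (0 < d)%N -> let u := a%:P * 'X in
  eq_modXn n ((1 - u) * geo d n a) (1 - u - y%:P * u ^+ d).
Proof.
move=> d_gt0 u i lt_in.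
have eq_uM p : (u * p)`_i = a * (if i is j.+1 then p`_j else 0).
  by rewrite -mulrA coefCM coefXM; case: i {lt_in}.
rewrite mulrBl mul1r !coefB eq_uM exprMn -polyC_exp !coefCM coefX coefXn.
rewrite /geo coefD coef_poly coefC lt_in.
case: i lt_in {eq_uM} => [|i] lt_in /=; first by rewrite ltn_eqF // mulr0n; ring.
rewrite coefD coef_poly coefC (ltnW lt_in) !eqSS.
case: i {lt_in} => [|i] /=.
  by case: d d_gt0 => [|[|d]] //= _; rewrite ?mulr1n ?mulr0n; ring.
case: (ltngtP d i.+2) => [lt_d|gt_d|->]; last 1 first.
- by rewrite ltnn mulr1n; ring.
- by rewrite -ltnS lt_d mulr0n exprS; ring.
by rewrite leqNgt (ltn_trans _ gt_d) //= mulr0n; ring.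
Qed.

(** The ratio of consecutive terms is D u^2 with D = 1 + y; the sign of the first
    term is -1 because e is odd. *)
Lemma oddgeo_factor e n a : odd e -> let u := a%:P * 'X in
  eq_modXn n ((1 - (1 + y)%:P * u ^+ 2) * oddgeo e n a)
        (1 - (1 + y)%:P * u ^+ 2 - y%:P * u ^+ e).
Proof.
move=> e_odd u i lt_in.
have eq_u2M p :
    ((1 + y)%:P * u ^+ 2 * p)`_i = (1 + y) * a ^+ 2 * (if i is j.+2 then p`_j else 0).
  have -> : (1 + y)%:P * u ^+ 2 * p = ((1 + y) * a ^+ 2)%:P * ('X^2 * p).
    by rewrite polyCM polyC_exp /u; ring.
  rewrite coefCM coefXnM; congr (_ * _).
  by case: i {lt_in} => [|[|i]] //=; rewrite subSS subn1.
rewrite mulrBl mul1r !coefB eq_u2M /u !exprMn -!polyC_exp !coefCM !coefXn.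
rewrite /oddgeo coefD coef_poly coefC lt_in /odd_weight.
case: i lt_in {eq_u2M} => [|[|i]] lt_in /=.
- by case: e e_odd => //= e _; rewrite mulr0n; ring.
- case: e e_odd => [|[|e]] //= _; rewrite ?subnn ?mulr0n ?mulr1n; ring.
rewrite coefD coef_poly coefC (ltn_trans _ lt_in) // negbK !eqSS.
have [i_odd | i_even] := boolP (odd i); last first.
  rewrite !andbF /= (_ : (i.+2 == e) = false); last first.
    by apply: contraNF i_even => /eqP e_def; rewrite -e_def /= negbK in e_odd.
  rewrite mulr0n; case: i {lt_in} i_even => [|i] _ /=; ring.
have i_gt0 : (0 < i)%N by case: i i_odd {lt_in}.
rewrite i_gt0 (gtn_eqF i_gt0) mulr0n /=.
case: (ltngtP e i.+2) => [lt_e|lt_e|e_def].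
- have le_ei : (e <= i)%N by lia.
  rewrite le_ei (_ : ((i.+2 - e) %/ 2 = ((i - e) %/ 2).+1)%N); last by lia.
  by rewrite mulr0n !exprS; ring.
- by rewrite leqNgt (ltn_trans _ lt_e) //= mulr0n; ring.
rewrite e_def leqNgt ltnS leqnSn /= subnn mulr1n -signr_odd /= negbK i_odd; ring.
Qed.

(** Once the denominators 1 - u and 1 - D u^2 are cleared, the two kinds of factors
    are related by
      (1 - u - y u^d) (1 + u) = 1 - D u^2 - y u^e,
    which amounts to u^d + u^(d+1) = u^2 + u^e: this is what singles out the two
    pairs (d, e).  The extra factor 1 + u completes the denominator 1 - u
    to 1 - u^2, and the products of the 1 - c u^2 are trivial for c = 1
    and c = D by hypothesis. *)
Lemma prod_geo_eq_oddgeo n k (Q : pred 'I_n) (a : 'I_n -> R) d e :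
    (d, e) \in [:: (1, 1); (2, 3)]%N ->
    (forall c, eq_modXn k (\prod_(i | Q i) (1 - c%:P * ((a i)%:P * 'X) ^+ 2)) 1) ->
  eq_modXn k (\prod_(i | Q i) geo d k (a i)) (\prod_(i | Q i) oddgeo e k (a i)).
Proof.
move=> de prod1.
have [d_gt0 e_odd] : (0 < d)%N /\ odd e.
  by move: de; rewrite !inE => /orP[]/eqP[-> ->].
have factor (u : {poly R}) :
    (1 - u - y%:P * u ^+ d) * (1 + u) = 1 - (1 + y)%:P * u ^+ 2 - y%:P * u ^+ e.
  by move: de; rewrite !inE polyCD => /orP[]/eqP[-> ->]; ring.
pose u i : {poly R} := (a i)%:P * 'X.
apply: (@eq_modXn_trans _ _ (\prod_(i | Q i) ((1 - 1%:P * u i ^+ 2) * geo d k (a i)))).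
  rewrite big_split /= -[X in eq_modXn _ X _]mul1r.
  by apply: eq_modXn_mul => //; apply: eq_modXn_sym.
apply: (@eq_modXn_trans _ _
  (\prod_(i | Q i) ((1 - (1 + y)%:P * u i ^+ 2) * oddgeo e k (a i)))).
  apply: eq_modXn_prod => i _.
  apply: (eq_modXn_trans _ (eq_modXn_sym (@oddgeo_factor e k (a i) e_odd))).
  rewrite -factor (_ : 1 - 1%:P * _ = (1 + u i) * (1 - u i)); last by rewrite polyC1; ring.
  rewrite -mulrA [X in eq_modXn _ _ X]mulrC; apply: eq_modXn_mul => //.
  exact: geo_factor.
rewrite big_split /= -[X in eq_modXn _ _ X]mul1r.
by apply: eq_modXn_mul => //; apply: prod1.
Qed.
End Factors.

(** * The product over the indices below p / 2 *)

Section HalfRange.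
Variables (F : fieldType) (p : nat).
Hypotheses (p_odd : odd p) (charFp : p \in [pchar F]).

Definition below_half (i : 'I_p) := (0 < i)%N && (2 * i < p)%N.

Lemma natr_neq0 m : (0 < m < p)%N -> m%:R != 0 :> F.
Proof.
case/andP=> m_gt0 lt_mp; rewrite -(dvdn_pcharf charFp).
by apply: contraL lt_mp => /(dvdn_leq m_gt0); rewrite leqNgt.
Qed.

Lemma prod_below_half (R : comPzRingType) (f : nat -> R) :
  \prod_(i < p | below_half i) f i = \prod_(i <- iota 1 p./2) f i.
Proof.
have -> : iota 1 p./2 = index_iota 1 p./2.+1 by rewrite /index_iota subSS subn0.
have le_hp : (p./2.+1 <= p)%N by rewrite -{2}(odd_double_half p) p_odd; lia.
rewrite -(big_mkord (fun i => (0 < i)%N && (2 * i < p)%N)) (big_nat_widenl 1 0) //.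
rewrite (big_nat_widen 0 p./2.+1 p) //; apply: eq_bigl => i /=.
by have := odd_double_half p; rewrite p_odd; lia.
Qed.

(** By Fermat each m^2 is a root of T^h - 1 with h = (p - 1) / 2, and these h
    squares are distinct because m = m' or m = - m' modulo p forces m = m' in the
    lower half.  So T^h - 1 is the product of the T - m^2; rescaling its factors
    costs a constant, which is found at T = 0. *)
Lemma half_range_product :
  \prod_(i < p | below_half i) (1 - ((i%:R^-1) ^+ 2)%:P * 'X) = 1 - 'X^(p./2) :> {poly F}.
Proof.
have p_def : (p./2 + p./2).+1 = p by have := odd_double_half p; rewrite p_odd; lia.
have h_gt0 : (0 < p./2)%N by have := pcharf_prime charFp; case: (p) p_odd => [|[|[]]].
set h := p./2 in p_def h_gt0 *.
rewrite (prod_below_half (fun i => 1 - ((i%:R^-1) ^+ 2)%:P * 'X)) -/h.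
pose rs : seq F := [seq i%:R ^+ 2 | i <- iota 1 h].
have in_iota i : i \in iota 1 h -> (0 < i <= h)%N by rewrite mem_iota add1n ltnS.
have rs_uniq : uniq rs.
  rewrite map_inj_in_uniq ?iota_uniq // => i j /in_iota i_in /in_iota j_in.
  wlog le_ij : i j i_in j_in / (i <= j)%N => [IH|].
    by case: (leqP i j) => [|/ltnW] le_ij eq_ij; [|symmetry]; apply: IH.
  move/eqP; rewrite eq_sym -subr_eq0 subr_sqr mulf_eq0 -natrB // -natrD.
  case/orP=> [|]; last by rewrite (negPf (natr_neq0 _)) //; lia.
  case: (ltngtP i j) le_ij => // lt_ij _.
  by rewrite (negPf (natr_neq0 _)) //; lia.
have rs_roots : all (root ('X^h - 1)) rs.
  apply/allP => _ /mapP[i /in_iota i_in ->].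
  rewrite /root !hornerE -exprM subr_eq0.
  have i_neq0 : i%:R != 0 :> F by apply: natr_neq0; lia.
  rewrite -(inj_eq (mulfI i_neq0)) mulr1 -exprS (_ : (2 * h).+1 = p); last by lia.
  by rewrite -(pFrobenius_autE charFp) pFrobenius_aut_nat.
have rs_prod : 'X^h - 1 = \prod_(z <- rs) ('X - z%:P).
  rewrite -[RHS]scale1r -(monicP (monicXnsubC 1 h_gt0)) polyC1.
  apply: all_roots_prod_XsubC => //.
    by rewrite -polyC1 size_XnsubC // size_map size_iota.
  by rewrite uniq_rootsE.
pose c : F := \prod_(i <- iota 1 h) - (i%:R^-1) ^+ 2.
have prodE : \prod_(i <- iota 1 h) (1 - ((i%:R^-1) ^+ 2)%:P * 'X) = c *: ('X^h - 1).
  rewrite rs_prod /c big_map -mul_polyC rmorph_prod -big_split /=.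
  rewrite !big_seq; apply: eq_bigr => i /in_iota i_in.
  have i_neq0 : i%:R != 0 :> F by apply: natr_neq0; lia.
  rewrite mulrBr -polyCM mulNr -exprMn mulVf // expr1n polyCN mulNr.
  by rewrite polyCN opprK polyC1 addrC.
have /(congr1 (fun q : {poly F} => q.[0])) := prodE.
rewrite horner_prod big1 => [|i _]; last by rewrite !hornerE subr0.
rewrite !hornerE expr0n (gtn_eqF h_gt0) sub0r mulrN1 => c_def.
by rewrite prodE -[c]opprK -c_def scaleN1r opprB.
Qed.

End HalfRange.

(** Here T is replaced by c X^2, so that T^((p-1)/2) has degree p - 1 in X. *)
Lemma half_range_product_modXn (F : fieldType) p k (c : {poly F}) :
    odd p -> p \in [pchar F] -> (k < p)%N ->
  eq_modXn k (\prod_(i < p | below_half i) (1 - c%:P * ((i%:R^-1)%:P%:P * 'X) ^+ 2)) 1.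
Proof.
move=> p_odd charFp lt_kp.
have /(congr1 (fun q => map_poly polyC q \Po (c%:P * 'X^2))) :=
  half_range_product p_odd charFp.
rewrite /= rmorphB /= map_polyXn rmorph1 !rmorph_prod /=.
under eq_bigr => i _.
  rewrite !rmorphB /= !rmorph1 !rmorphM /= map_polyX map_polyC /= comp_polyC comp_polyX.
  rewrite (_ : _ - _ = 1 - c%:P * ((i%:R^-1)%:P%:P * 'X) ^+ 2); last first.
    by ring.
  over.
move=> -> i lt_ik; rewrite rmorphB /= rmorph1 rmorphXn /= comp_polyX.
rewrite exprMn -polyC_exp -exprM coefB coefCM coefXn.
have := odd_double_half p; rewrite p_odd => p_def.
by rewrite (_ : (i == 2 * p./2)%N = false) ?mulr0 ?subr0 //; lia.
Qed.

(** * The identities over a field of characteristic p *)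

Definition compsum (R : comPzRingType) n (Q : pred 'I_n) (a : 'I_n -> R) (P : pred nat)
    k r : R :=
  \sum_(t : r.-tuple 'I_k.+1 | composition P t) monomial_qsym Q a (fun l => tnth t l).

Lemma compsum_polyC (R : comNzRingType) n (Q : pred 'I_n) (a : 'I_n -> R) P k r :
  compsum Q (fun i => (a i)%:P) P k r = (compsum Q a P k r)%:P.
Proof.
rewrite rmorph_sum; apply: eq_bigr => t _; rewrite rmorph_sum; apply: eq_bigr => m _.
by rewrite rmorph_prod; apply: eq_bigr => l _; rewrite rmorphXn.
Qed.

Lemma coef_geo_prod (R : comNzRingType) (y : R) n N k (Q : pred 'I_n) (a : 'I_n -> R) d :
    (n < N)%N ->
  (\prod_(i | Q i) geo y d k.+1 (a i))`_k =
  \sum_(r < N) (- y) ^+ r * compsum Q a (leq d) k r.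
Proof.
move=> ltnN; rewrite (coef_prod_parts _ _ (leq d) _ (fun=> - y) ltnN).
apply: eq_bigr => r _; rewrite mulr_sumr; apply: eq_bigr => t _.
by rewrite prodr_const card_ord.
Qed.

(** All parts exceed e by an even number, so the halved excesses that appear as
    exponents in the weight add up to (k - e r) / 2, without rounding. *)
Lemma odd_composition_sum e k r (t : r.-tuple 'I_k.+1) :
    odd e -> composition (fun j => odd j && (e <= j)%N) t ->
  k = (e * r + 2 * \sum_(l < r) (tnth t l - e) %/ 2)%N.
Proof.
move=> e_odd /andP[/eqP sum_t /forallP t_odd].
rewrite -[LHS]sum_t big_distrr /= mulnC -[X in (X * e)%N]card_ord -sum_nat_const.
rewrite -big_split /=; apply: eq_bigr => l _.
by have := t_odd l; lia.
Qed.

(** A sum of r odd parts has the parity of r, and k > 0 has no composition without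
    parts; so the indices missing from the sums in the theorem contribute
    nothing. *)
Lemma compsum_odd_eq0 (R : comPzRingType) n (Q : pred 'I_n) (a : 'I_n -> R) e k r :
    odd e -> (0 < k)%N -> ~~ ((0 < r)%N && (r == k %[mod 2])) ->
  compsum Q a (fun j => odd j && (e <= j)%N) k r = 0.
Proof.
move=> e_odd k_gt0 bad; apply: big_pred0 => t; apply: contraNF bad => t_comp.
have := odd_composition_sum e_odd t_comp.
case: r t t_comp => [|r] t _ k_def; first by move: k_def; rewrite big_ord0; lia.
have /(congr1 odd) := k_def; rewrite oddD !oddM e_odd addbF /= !modn2 => ->.
by rewrite eqxx.
Qed.

Lemma coef_oddgeo_prod (R : comNzRingType) (y : R) n N k (Q : pred 'I_n)
    (a : 'I_n -> R) e :
    (n < N)%N -> odd e ->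
  (\prod_(i | Q i) oddgeo y e k.+1 (a i))`_k =
  \sum_(r < N) y ^+ r * (-1) ^+ k * (1 + y) ^+ ((k - e * r) %/ 2)
                 * compsum Q a (fun j => odd j && (e <= j)%N) k r.
Proof.
move=> ltnN e_odd.
rewrite (coef_prod_parts _ _ (fun j => odd j && (e <= j)%N) _ (odd_weight y e) ltnN).
apply: eq_bigr => r _; rewrite mulr_sumr; apply: eq_bigr => t t_comp.
congr (_ * _); rewrite /odd_weight !big_split /= prodr_const card_ord -!expr_sum.
have [/eqP-> _] := andP t_comp; congr (_ * _ ^+ _).
have k_def := odd_composition_sum e_odd t_comp.
by rewrite [X in ((X - _) %/ 2)%N]k_def addKn mulKn.
Qed.

Lemma coef_1DX_exp (R : comNzRingType) m j : ((1 + 'X) ^+ m : {poly R})`_j = 'C(m, j)%:R.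
Proof.
rewrite exprDn coef_sum.
case: (leqP j m) => [le_jm | lt_mj].
  have lt_jm : (j < m.+1)%N by [].
  rewrite (bigD1 (Ordinal lt_jm)) //= big1 => [|i /eqP ne_ij].
    by rewrite addr0 expr1n mul1r coefMn coefXn eqxx.
  rewrite expr1n mul1r coefMn coefXn; case: eqP => [eq_ji|]; last by rewrite mul0rn.
  by case: ne_ij; apply: val_inj.
rewrite bin_small // big1 // => i _; rewrite expr1n mul1r coefMn coefXn gtn_eqF ?mul0rn //.
by apply: leq_trans lt_mj; rewrite ltnS -ltnS.
Qed.

Lemma coef_signXn (R : comNzRingType) i c j :
  ((- 'X) ^+ i * c%:P : {poly R})`_j = (-1) ^+ i * (j == i)%:R * c.
Proof.
have -> : (- 'X) ^+ i = ((-1) ^+ i)%:P * 'X^i :> {poly R}.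
  by rewrite rmorph_sign [LHS]exprNn.
by rewrite coefMC coefCM coefXn.
Qed.

Lemma coef_XnDXn (R : comNzRingType) i k m c j :
  ('X ^+ i * (-1) ^+ k * (1 + 'X) ^+ m * c%:P : {poly R})`_j =
  (-1) ^+ k * (if (j < i)%N then 0 else 'C(m, j - i)%:R) * c.
Proof.
have -> : 'X ^+ i * (-1) ^+ k * (1 + 'X) ^+ m * c%:P
  = ((-1) ^+ k * c)%:P * ('X^i * (1 + 'X) ^+ m) :> {poly R}.
  by rewrite rmorphM rmorph_sign /=; ring.
by rewrite coefCM coefXnM coef_1DX_exp mulrAC.
Qed.

Section FieldIdentity.
Variables (F : fieldType) (p : nat).
Hypotheses (p_odd : odd p) (charFp : p \in [pchar F]).
Let zsum := compsum (@below_half p) (fun i => i%:R^-1 : F).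

(** The coefficient of X^k Y^r in [prod_geo_eq_oddgeo] for the indeterminate Y,
    over the coefficient ring F[Y].  The congruence modulo X^(k+1) requires
    k + 1 < p. *)
Lemma compsum_identity k r d e :
    (d, e) \in [:: (1, 1); (2, 3)]%N -> (0 < k)%N -> (k.+1 < p)%N ->
  zsum (leq d) k r =
  (-1) ^+ (k + r) *
    \sum_(1 <= i < r.+1 | i == k %[mod 2])
      'C((k - e * i) %/ 2, r - i)%:R * zsum (fun j => odd j && (e <= j)%N) k i.
Proof.
move=> de k_gt0 lt_kp.
have e_odd : odd e by move: de; rewrite !inE => /orP[]/eqP[_ ->].
pose N := (p + r).+1.
have ltpN : (p < N)%N by rewrite ltnS leq_addr.
have ltrN : (r < N)%N by rewrite ltnS leq_addl.
have trunc1 c := half_range_product_modXn (k := k.+1) c p_odd charFp lt_kp.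
have := prod_geo_eq_oddgeo ('X : {poly F}) de trunc1 (ltnSn k).
rewrite (coef_geo_prod _ _ _ _ _ ltpN) (coef_oddgeo_prod _ _ _ _ ltpN e_odd).
move/(congr1 (fun q : {poly F} => q`_r)); rewrite /= !coef_sum.
rewrite (bigD1 (Ordinal ltrN)) //= big1 ?addr0; last first.
  move=> i /eqP ne_ir; rewrite compsum_polyC coef_signXn.
  by case: eqP => [eq_ri|]; [case: ne_ir; apply: val_inj | rewrite !(mulr0, mul0r)].
rewrite compsum_polyC coef_signXn eqxx mulr1 -/zsum => eq_r.
apply: (mulrI (unitrX r (unitrN1 F))); rewrite eq_r.
rewrite mulrA -exprD addnCA addnn exprD -mul2n exprM sqrrN !expr1n mulr1 mulr_sumr.
(* Both sides are sums over i < N of this term, which vanishes outside the range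
   of the sum on the right. *)
pose g i := (-1) ^+ k * (if (r < i)%N then 0 else 'C((k - e * i) %/ 2, r - i)%:R)
            * zsum (fun j => odd j && (e <= j)%N) k i.
transitivity (\sum_(0 <= i < N) g i).
  rewrite big_mkord; apply: eq_bigr => i _.
  by rewrite compsum_polyC coef_XnDXn.
rewrite [RHS](big_nat_widenl 1 0) // [RHS](big_nat_widen 0 r.+1 N) // [RHS]big_mkcond.
apply: eq_bigr => i _; rewrite /g ltnS [(i <= r)%N]leqNgt.
case: (r < i)%N => /=; first by rewrite andbF mulr0 mul0r.
rewrite andbT; case: ifP => [_|/negbT bad]; first by rewrite mulrA.
by rewrite /zsum compsum_odd_eq0 ?mulr0 // andbC.
Qed.
End FieldIdentity.

(** * Passage to the quotient ring *)

Local Notation piA := (\pi_calA%qT).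

(** The evaluation at a prime, named so as to carry a ring morphism structure. *)
Definition coord (p : primeT) (f : prodF) : 'F_(sval p) := f p.

Fact coord_is_zmod_morphism p : zmod_morphism (coord p).
Proof. by []. Qed.
HB.instance Definition _ p :=
  GRing.isZmodMorphism.Build prodF 'F_(sval p) (coord p) (@coord_is_zmod_morphism p).

Fact coord_is_monoid_morphism p : monoid_morphism (coord p).
Proof. by []. Qed.
HB.instance Definition _ p :=
  GRing.isMonoidMorphism.Build prodF 'F_(sval p) (coord p) (@coord_is_monoid_morphism p).

Lemma eq_calA N (f g : prodF) :
  (forall p : primeT, (N <= sval p)%N -> f p = g p) -> piA f = piA g.
Proof.
move=> eq_fg; apply/eqP; rewrite -Quotient.idealrBE; apply/asboolP.
exists (iota 0 N) => p; rewrite mem_iota -leqNgt => le_Np.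
by rewrite -[LHS]/(f p - g p) eq_fg ?subrr.
Qed.

Definition zsum_family (P : pred nat) k r : prodF := fun p =>
  compsum (@below_half (sval p)) (fun i => i%:R^-1 : 'F_(sval p)) P k r.

Lemma sumzetaE P k r : sumzeta P k r = piA (zsum_family P k r).
Proof.
rewrite /sumzeta -rmorph_sum; apply: (@eq_calA 0) => p _.
rewrite -[LHS]/(coord p _) rmorph_sum; apply: eq_bigr => t _.
apply: eq_bigr => m _; rewrite -prodfV; apply: eq_bigr => l _.
by rewrite exprVn tnth_map.
Qed.

Lemma sumzeta_identity k r d e :
    (d, e) \in [:: (1, 1); (2, 3)]%N -> (0 < k)%N ->
  sumzeta (leq d) k r =
  (-1) ^+ (k + r) *
    \sum_(1 <= i < r.+1 | i == k %[mod 2])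
      'C((k - e * i) %/ 2, r - i)%:R * sumzeta (fun j => odd j && (e <= j)%N) k i.
Proof.
move=> de k_gt0.
under eq_bigr do rewrite sumzetaE -(rmorph_nat piA) -rmorphM.
rewrite sumzetaE -rmorph_sum -(rmorph_sign piA) -rmorphM.
apply: (@eq_calA k.+3) => p lt_kp.
rewrite -[RHS]/(coord p _) rmorphM rmorph_sign rmorph_sum.
under eq_bigr do rewrite rmorphM rmorph_nat.
have p_pr := svalP p.
have p_odd : odd (sval p) by case: (even_prime p_pr) lt_kp => // ->.
exact: compsum_identity p_odd (pchar_Fp p_pr) _ _ _ _ de k_gt0 (ltnW lt_kp).
Qed.

(* In the second identity k - 3 * i is truncated subtraction; when k < 3 * i
   the factor B1 k i is an empty sum, so the binomial is immaterial. *)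
Theorem theorem3p1 (k r : nat) (hr : (1 <= r)%N) (hrk : (r <= k)%N) :
  Ssum k r = (-1) ^+ (k + r) *
    \sum_(1 <= i < r.+1 | i == k %[mod 2]) 'C((k - i) %/ 2, r - i)%:R * Bsum k i
  /\
  S1sum k r = (-1) ^+ (k + r) *
    \sum_(1 <= i < r.+1 | i == k %[mod 2]) 'C((k - 3 * i) %/ 2, r - i)%:R * B1sum k i.
Proof.
have k_gt0 := leq_trans hr hrk.
split; last exact: (@sumzeta_identity k r 2 3).
transitivity (sumzeta (leq 1) k r).
  apply: eq_bigl => t; congr (_ && _); apply: eq_forallb => i.
  by rewrite andbT andbb.
rewrite (@sumzeta_identity k r 1 1) //; congr (_ * _).
by apply: eq_bigr => i _; rewrite mul1n.
Qed.
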